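(* Let $M$ be a closed $C^2$ embedded curve in the plane $\mathbb{R}^2$ (with coordinates $(x_1,x_2)$) such that $M$ stays on one side of any line parallel to the $x_2$-axis that is tangent to $M$. Assume that whenever $(x_1,a)$ and $(x_1,b)$, with $a<b$, lie on $M$, $$\text{curvature of } M \text{ at } (x_1,b)\ \le\ \text{curvature of } M \text{ at } (x_1,a).$$ Then $M$ is symmetric about some line $x_2=\lambda_0$.
   Context: Curvature is the signed curvature of the closed embedded curve $M$ computed with respect to the interior normal (so that a circle has positive curvature). ''$M$ stays on one side of a line'' means that $M$ is contained in one of the two closed half-planes bounded by that line. *)

(* Defs.v *)
From HB Require Import structures.
From mathcomp Require Import all_boot all_order all_algebra.
From mathcomp Require Import all_classical all_reals all_analysis.

Set Implicit Arguments.
Unset Strict Implicit.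
Unset Printing Implicit Defensive.

Import Order.TTheory GRing.Theory Num.Theory.
Import numFieldNormedType.Exports.
Local Open Scope ring_scope.
Local Open Scope classical_set_scope.

(* The plane is R * R; the product carries the sup norm, so the Euclidean
   inner product is defined separately. *)

Definition dot {R : realType} (u v : R * R) : R := u.1 * v.1 + u.2 * v.2.

Definition C2 {R : realType} (f : R -> R) : Prop :=
  [/\ forall t, derivable f t 1,
      forall t, derivable f^`() t 1
    & continuous f^`(2)].

Definition velocity {R : realType} (g : R -> R * R) (t : R) : R * R :=
  ((fst \o g)^`() t, (snd \o g)^`() t).

Definition acceleration {R : realType} (g : R -> R * R) (t : R) : R * R :=
  ((fst \o g)^`(2) t, (snd \o g)^`(2) t).

(* g is an L-periodic regular C^2 parametrization of M which is injective on a
   period, i.e. a C^2 embedding of the circle R / LZ with image M. *)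
Definition closed_C2_param {R : realType} (M : set (R * R)) (L : R)
    (g : R -> R * R) : Prop :=
  [/\ 0 < L,
      C2 (fst \o g) /\ C2 (snd \o g),
      forall t, velocity g t != (0, 0),
      (forall t, g (t + L) = g t) /\ {in `[0, L[ &, injective g}
    & range g = M].

Definition closed_C2_embedded_curve {R : realType} (M : set (R * R)) : Prop :=
  exists (L : R) (g : R -> R * R), closed_C2_param M L g.

(* The region enclosed by M: the union of the bounded connected components of
   the complement of M. *)
Definition inside {R : realType} (M : set (R * R)) : set (R * R) :=
  [set p | ~ M p /\ bounded_set (connected_component (~` M) p)].

Definition is_interior_normal {R : realType} (M : set (R * R))
    (g : R -> R * R) (t : R) (n : R * R) : Prop :=
  [/\ dot n n = 1,
      dot n (velocity g t) = 0
    & \forall s \near 0^'+, inside M ((g t).1 + s * n.1, (g t).2 + s * n.2)].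

(* k is the signed curvature of M at p with respect to the interior normal n.
   Along a regular parametrization, g'' = |g'|' T + |g'|^2 K, where T is the
   unit tangent and K the curvature vector, so that k = <K, n> is
   <g'', n> / |g'|^2; it is positive for a circle. *)
Definition is_curvature {R : realType} (M : set (R * R)) (p : R * R) (k : R)
    : Prop :=
  exists (L : R) (g : R -> R * R) (t : R) (n : R * R),
    [/\ closed_C2_param M L g,
        g t = p,
        is_interior_normal M g t n
      & k = dot (acceleration g t) n / dot (velocity g t) (velocity g t)].

Definition is_tangent_line {R : realType} (M l : set (R * R)) : Prop :=
  exists (L : R) (g : R -> R * R) (t : R),
    closed_C2_param M L g /\
    l = [set ((g t).1 + s * (velocity g t).1, (g t).2 + s * (velocity g t).2)
        | s in [set: R]].

Definition vertical_line {R : realType} (c : R) : set (R * R) :=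
  [set p | p.1 = c].

Definition on_one_side_of_vertical {R : realType} (M : set (R * R)) (c : R)
    : Prop :=
  M `<=` [set p | p.1 <= c] \/ M `<=` [set p | c <= p.1].

Definition symmetric_about_horizontal {R : realType} (M : set (R * R)) (l : R)
    : Prop :=
  [set (p.1, 2 * l - p.2) | p in M] = M.

(* Main.v *)
(* The tangent at a critical point of the first coordinate u of a parametrization
   is vertical, so by the one-side hypothesis u attains its minimum A or its
   maximum B there. Hence between A and B the curve consists of graphs, and
   embeddedness forces exactly two of them, f1 < f2 over [A, B], closed up by
   (possibly degenerate) vertical segments. The interior is the strip between
   them, so the curvature hypothesis reads
     (f2' / sqrt (1 + f2'^2))' + (f1' / sqrt (1 + f1'^2))' >= 0.
   The sum of the two quotients is thus nondecreasing, and it vanishes at A and at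
   B, where the slopes are infinite of opposite signs. So it is 0, which gives
   f1' = - f2' and f1 + f2 constant. *)
Require Import Defs.
From mathcomp Require Import all_boot all_order all_algebra.
From mathcomp Require Import all_classical all_reals all_analysis.
From mathcomp Require Import ring lra.
Set Implicit Arguments.
Unset Strict Implicit.
Unset Printing Implicit Defensive.

Import Order.TTheory GRing.Theory Num.Theory.
Import numFieldNormedType.Exports.
Local Open Scope ring_scope.
Local Open Scope classical_set_scope.

(** * Continuous real functions *)

(** The slopes blow up over A and B, so the argument is carried by the sine of the tangent angle,
    [tan_sin]: it is continuous along the whole curve, and no limit at the ends has to be taken. Its
    derivative with respect to the first coordinate along an arc is the curvature for the left
    normal, so one must know on which side the interior lies, while it is not known in advance which
    arc is the lower one. Both questions are settled by starting from a lowest point of M on the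
    line midway between x1 = A and x1 = B: the arc through it is the lower graph and, after reversal
    of the parametrization if need be, it runs rightwards, so that the strip is to the left of both
    arcs. For the interior normals it is then enough that the strip lies in [inside M], which
    follows by connectedness once M is identified with [strip_boundary]. *)

(** A level set on a segment is compact. With h the identity or its opposite this gives first and
    last times; with h = v, a lowest point of the curve on a vertical line. *)
Lemma level_min (R : realType) (f h : R -> R) (a b c : R) :
  continuous f -> continuous h -> (exists t, a <= t <= b /\ f t = c) ->
  exists t, [/\ a <= t <= b, f t = c
    & forall s, a <= s <= b -> f s = c -> h t <= h s].
Proof.
move=> fc hc [t0 [t0ab ft0]].
pose K := `[a, b] `&` f @^-1` [set c].
have K0 : K !=set0 by exists t0; split; rewrite //= in_itv.
have cK : compact K.
  apply: compact_closedI; first exact: segment_compact.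
  by apply: closed_comp => [x _|]; [exact: fc | exact: closed_eq].
have [t] := compact_EVT_min K0 cK (continuous_subspaceT hc).
rewrite inE => -[/=]; rewrite in_itv /= => tab ft tmin.
exists t; split=> // s sab fs; apply: tmin.
by rewrite inE; split; rewrite //= in_itv.
Qed.

Lemma first_time (R : realType) (f : R -> R) (a b c : R) :
  continuous f -> (exists t, a <= t <= b /\ f t = c) ->
  exists t, [/\ a <= t <= b, f t = c & forall s, a <= s < t -> f s <> c].
Proof.
move=> fc ex; have ic : continuous (fun x : R => x) by move=> x; exact: cvg_id.
have [t [tab ft tmin]] := level_min fc ic ex.
exists t; split=> // s /andP[as_ st] fs.
have := tmin s _ fs; move: tab => /andP[_ tb].
by rewrite as_ (ltW (lt_le_trans st tb)) leNgt st => /(_ isT).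
Qed.

Lemma last_time (R : realType) (f : R -> R) (a b c : R) :
  continuous f -> (exists t, a <= t <= b /\ f t = c) ->
  exists t, [/\ a <= t <= b, f t = c & forall s, t < s <= b -> f s <> c].
Proof.
move=> fc ex; have [t [tab ft tmin]] := level_min fc (@opp_continuous R) ex.
exists t; split=> // s /andP[ts sb] fs.
have := tmin s _ fs; move: tab => /andP[ta _].
by rewrite sb (ltW (le_lt_trans ta ts)) /= lerN2 leNgt ts => /(_ isT).
Qed.

Lemma ivt_segment (R : realType) (f : R -> R) (a b y : R) :
  continuous f -> a <= b -> f a <= y <= f b \/ f b <= y <= f a ->
  exists t, a <= t <= b /\ f t = y.
Proof.
move=> fc ab h.
have [|t] := IVT ab (continuous_subspaceT fc) (v := y).
  by rewrite ge_min le_max; case: h => /andP[-> ->]; rewrite ?orbT.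
by rewrite in_itv /=; exists t.
Qed.

(** Precomposition with [clamp a b] turns a function continuous on [a, b] into one continuous on the
    whole line, with the same values on [a, b]. *)
Definition clamp (R : realType) (a b x : R) := Num.min (Num.max x a) b.

Lemma clamp_itv (R : realType) (a b x : R) : a <= b -> a <= clamp a b x <= b.
Proof. by move=> ab; rewrite /clamp le_min ge_min lexx orbT ab le_max lexx orbT. Qed.

Lemma clamp_id (R : realType) (a b x : R) : a <= x <= b -> clamp a b x = x.
Proof. by move=> /andP[ax xb]; rewrite /clamp (max_idPl ax) (min_idPl xb). Qed.

Lemma clamp_continuous (R : realType) (a b : R) : continuous (clamp a b).
Proof.
apply: (@min_fun_continuous _ R R (fun x => Num.max x a)); last exact: cst_continuous.
apply: (@max_fun_continuous _ R R id); last exact: cst_continuous.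
by move=> x; exact: cvg_id.
Qed.

Lemma clamp_comp_continuous (R : realType) (a b : R) (f : R -> R) : a <= b ->
  {within `[a, b], continuous f} -> continuous (f \o clamp a b).
Proof.
move=> ab /subspace_continuousP fc x.
have cx : `[a, b]%classic (clamp a b x) by rewrite /= in_itv /= clamp_itv.
apply: cvg_comp (fc _ cx) => P /= nP.
have := @clamp_continuous R a b x _ nP.
rewrite !nbhs_simpl /=; apply: filterS => z; apply.
by rewrite in_itv /= clamp_itv.
Qed.

Lemma increasing_section (R : realType) (u : R -> R) (s t : R) :
  continuous u -> s < t -> u s < u t -> {in `[s, t]%R &, injective u} ->
  exists al : R -> R, [/\ continuous al, forall x, s <= al x <= t,
    forall r, s <= r <= t -> al (u r) = r
    & forall x, u s <= x <= u t -> u (al x) = x].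
Proof.
move=> uc st ust uinj; have st' := ltW st; have ust' := ltW ust.
(* The default s is harmless: below, [g] receives only clamped arguments, which lie in
   [u s, u t]. *)
pose g x := xget s [set r | s <= r <= t /\ u r = x].
have gP x : u s <= x <= u t -> s <= g x <= t /\ u (g x) = x.
  move=> xst; rewrite /g; case: xgetP => // /(_ _) + .
  have [r rP] := ivt_segment uc st' (or_introl xst).
  by move=> /(_ r).
have gK : {in `[s, t]%R, cancel u g}.
  move=> r rst.
  have umono := segment_continuous_inj_le ust' (continuous_subspaceT uc) uinj.
  have [|gr1 gr2] := gP (u r).
    by move: (rst); rewrite in_itv /= => /andP[sr rt]; rewrite !umono ?sr ?rt // in_itv /= lexx st'.
  by apply: uinj => //; rewrite in_itv.
exists (g \o clamp (u s) (u t)); split.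
- apply: clamp_comp_continuous => //.
  exact: segment_can_le_continuous st' (continuous_subspaceT uc) gK.
- by move=> x /=; case: (gP _ (clamp_itv x ust')).
- move=> r rst; rewrite /= clamp_id ?gK //.
  have umono := segment_continuous_inj_le ust' (continuous_subspaceT uc) uinj.
  by move: (rst) => /andP[sr rt]; rewrite !umono ?sr ?rt // in_itv /= ?lexx ?st'.
- by move=> x xst; rewrite /= clamp_id //; case: (gP x xst).
Qed.

Lemma decreasing_section (R : realType) (u : R -> R) (s t : R) :
  continuous u -> s < t -> u t < u s -> {in `[s, t]%R &, injective u} ->
  exists al : R -> R, [/\ continuous al, forall x, s <= al x <= t,
    forall r, s <= r <= t -> al (u r) = r
    & forall x, u t <= x <= u s -> u (al x) = x].
Proof.
move=> uc st ust uinj.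
have [||x y xs ys /= /oppr_inj|al [alc al1 al2 al3]] :=
    @increasing_section R (fun r => - u r) s t _ st.
- by move=> x; apply: continuousN; exact: uc.
- by rewrite ltrN2.
- exact: uinj.
exists (fun x => al (- x)); split=> // x.
- by apply: continuous_comp; [exact: opp_continuous | exact: alc].
- by move=> /andP[h1 h2]; apply: oppr_inj; rewrite al3 // !lerN2 h1 h2.
Qed.

(** A change of order would produce a zero of the difference, by the intermediate value theorem. *)
Lemma graphs_ordered (R : realType) (f1 f2 : R -> R) (a b c : R) :
  continuous f1 -> continuous f2 -> (forall x, a < x < b -> f1 x <> f2 x) ->
  a < c < b -> f1 c < f2 c -> forall x, a < x < b -> f1 x < f2 x.
Proof.
move=> c1 c2 ne /andP[ac cb] fc x /andP[ax xb]; rewrite ltNge; apply/negP => fx.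
pose h y := f1 y - f2 y.
have hc : continuous h by move=> y; apply: continuousB; [exact: c1 | exact: c2].
have [cx|xc] := leP c x.
- have [|y [/andP[y1 y2] /eqP]] := ivt_segment (y := 0) hc cx _.
    by left; rewrite /h subr_le0 subr_ge0 fx ltW.
  by rewrite subr_eq0 => /eqP; apply: ne; rewrite (lt_le_trans ac y1) (le_lt_trans y2 xb).
- have [|y [/andP[y1 y2] /eqP]] := ivt_segment (y := 0) hc (ltW xc) _.
    by right; rewrite /h subr_le0 subr_ge0 fx ltW.
  by rewrite subr_eq0 => /eqP; apply: ne; rewrite (lt_le_trans ax y1) (le_lt_trans y2 cb).
Qed.

Lemma le_closed_itv (R : realType) (f1 f2 : R -> R) (a b : R) :
  continuous f1 -> continuous f2 -> a < b -> (forall x, a < x < b -> f1 x <= f2 x) ->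
  forall x, a <= x <= b -> f1 x <= f2 x.
Proof.
move=> c1 c2 ab le12 x /andP[ax xb]; rewrite leNgt; apply/negP => fx.
pose h y := f1 y - f2 y.
have hc : continuous h by move=> y; apply: continuousB; [exact: c1 | exact: c2].
have : \forall y \near x, 0 < h y.
  by have := hc x; move/cvgr_gt; apply; rewrite subr_gt0.
move=> [e /= e0 He].
have [] : exists y, a < y < b /\ `|x - y| < e.
  (* Moving x by d / 2 in the direction of the midpoint of [a, b] leads into the open interval even
     when x is an endpoint. *)
  pose d := Num.min (e / 2) ((b - a) / 2).
  have d0 : 0 < d by rewrite lt_min !divr_gt0 // subr_gt0.
  have de : d <= e / 2 by rewrite ge_min lexx.
  have db : d <= (b - a) / 2 by rewrite ge_min lexx orbT.
  have [xm|xm] := leP x ((a + b) / 2).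
    exists (x + d / 2); split; first by apply/andP; split; lra.
    by rewrite opprD addrA subrr sub0r normrN gtr0_norm; lra.
  exists (x - d / 2); split; first by apply/andP; split; lra.
  by rewrite opprB addrC subrK gtr0_norm; lra.
move=> y [yab yx]; have := He y yx; rewrite subr_gt0 ltNge.
by rewrite le12.
Qed.

Lemma injective_segment (R : realType) (f : R -> R) (a b : R) :
  (forall s t, a <= s -> s < t -> t <= b -> f s <> f t) ->
  {in `[a, b]%R &, injective f}.
Proof.
move=> ne s t; rewrite !in_itv /= => /andP[as_ sb] /andP[at_ tb] e.
have [st|ts|//] := ltgtP s t; first by case: (ne s t as_ st tb).
by case: (ne t s at_ ts sb).
Qed.

(** * Decomposition of the curve into two arcs *)

(* [loop_crit] is what remains, by Rolle's theorem, of the fact that every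
   critical point of u is a global extremum. *)
Record extremal_loop (R : realType) (L A B : R) (u v : R -> R) : Prop :=
  ExtremalLoop {
    loop_L : 0 < L;
    loop_AB : A < B;
    loop_uc : continuous u;
    loop_vc : continuous v;
    loop_up : forall t, u (t + L) = u t;
    loop_vp : forall t, v (t + L) = v t;
    loop_inj : forall s t, s < t -> t < s + L -> u s = u t -> v s <> v t;
    loop_bd : forall t, A <= u t <= B;
    loop_crit : forall s t, s < t -> u s = u t ->
      exists r, s < r < t /\ (u r = A \/ u r = B) }.

Definition crossing (R : realType) (A B : R) (u : R -> R) (s t : R) : Prop :=
  [/\ s < t, (u s = A /\ u t = B) \/ (u s = B /\ u t = A)
    & forall r, s < r < t -> A < u r < B].

(* [al] is required to be continuous on the whole line, not only on [A, B], so
   that no subspace topology is needed later. *)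
Record arc_inverse (R : realType) (A B : R) (u : R -> R) (s t : R)
    (al : R -> R) : Prop := ArcInverse {
  inv_cont : continuous al;
  inv_itv : forall x, s <= al x <= t;
  inv_K : forall r, s <= r <= t -> al (u r) = r;
  inv_VK : forall x, A <= x <= B -> u (al x) = x }.

(** A value of u taken twice on the arc would force, by [loop_crit], an extreme value strictly
    inside it; so u is injective there. *)
Lemma arc_inverse_ex (R : realType) (L A B : R) (u v : R -> R) (s t : R) :
  extremal_loop L A B u v -> crossing A B u s t -> exists al, arc_inverse A B u s t al.
Proof.
move=> lp [st ends ins].
have uinj : {in `[s, t]%R &, injective u}.
  apply: injective_segment => x y sx xy yt uxy.
  have [r [/andP[xr ry] e]] := loop_crit lp xy uxy.
  have /ins/andP[h1 h2] : s < r < t by rewrite (le_lt_trans sx xr) (lt_le_trans ry yt).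
  by case: e => e; move: h1 h2; rewrite e ltxx.
have AB := loop_AB lp; have uc := loop_uc lp.
case: ends => -[us ut].
  have [|al [h1 h2 h3 h4]] := increasing_section uc st _ uinj; first by rewrite us ut.
  by exists al; split => //; rewrite -us -ut.
have [|al [h1 h2 h3 h4]] := decreasing_section uc st _ uinj; first by rewrite us ut.
by exists al; split => //; rewrite -us -ut.
Qed.

Lemma inv_itvoo (R : realType) (A B : R) (u : R -> R) (s t : R) (al : R -> R) :
  crossing A B u s t -> arc_inverse A B u s t al ->
  forall x, A < x < B -> s < al x < t.
Proof.
move=> [st ends ins] inv x /andP[Ax xB].
have ux : u (al x) = x by rewrite (inv_VK inv) // !ltW.
have /andP[h1 h2] := inv_itv inv x.
rewrite !lt_neqAle h1 h2 !andbT; apply/andP; split; apply/eqP => e; move: ux Ax xB.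
  by rewrite -e; case: ends => -[-> _] ->; rewrite ltxx.
by rewrite e; case: ends => -[_ ->] ->; rewrite ltxx.
Qed.

(** Both arcs fit into one period, so a common point would be visited at two distinct times of that
    period. *)
Lemma arcs_disjoint (R : realType) (L A B : R) (u v : R -> R)
    (p0 p1 q0 q1 : R) (al be : R -> R) :
  extremal_loop L A B u v ->
  crossing A B u p0 p1 -> arc_inverse A B u p0 p1 al ->
  crossing A B u q0 q1 -> arc_inverse A B u q0 q1 be ->
  p1 <= q0 -> q1 <= p0 + L ->
  forall x, A < x < B -> v (al x) <> v (be x).
Proof.
move=> lp ap ip aq iq pq qp x xAB.
have /andP[a1 a2] := inv_itvoo ap ip xAB.
have /andP[b1 b2] := inv_itvoo aq iq xAB.
have xAB' : A <= x <= B by case/andP: xAB => /ltW -> /ltW ->.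
apply: (loop_inj lp); [lra|lra|].
by rewrite (inv_VK ip) // (inv_VK iq).
Qed.

(** Around a time r with u r <> c, the last earlier and the first later visit to c enclose, by the
    criticality hypothesis, a time with value c or d, and both are excluded. With c and d the two
    extremes, in either order, this produces the vertical pieces of the curve. *)
Lemma plateau (R : realType) (u : R -> R) (c d a b : R) :
  continuous u ->
  (forall s t, s < t -> u s = u t -> exists r, s < r < t /\ (u r = c \/ u r = d)) ->
  u a = c -> u b = c -> (forall r, a <= r <= b -> u r <> d) ->
  forall r, a <= r <= b -> u r = c.
Proof.
move=> uc crit ua ub nd r /andP[ar rb]; apply: contrapT => ur.
have [|s [/andP[as_ sr] us smax]] := @last_time _ u a r c uc.
  by exists a; rewrite lexx.
have [|t [/andP[rt tb] ut tmin]] := @first_time _ u r b c uc.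
  by exists b; rewrite lexx rb.
have sr' : s < r by rewrite lt_neqAle sr andbT; apply/eqP => e; apply: ur; rewrite -e.
have rt' : r < t by rewrite lt_neqAle rt andbT; apply/eqP => e; apply: ur; rewrite e.
have [|q [/andP[sq qt] [uq|uq]]] := crit s t (lt_trans sr' rt'); first by rewrite us ut.
- have [qr|rq] := leP q r; first by apply: (smax q) => //; rewrite sq.
  by apply: (tmin q) => //; rewrite qt ltW.
- by apply: (nd q) => //; rewrite (le_trans as_ (ltW sq)) (le_trans (ltW qt) tb).
Qed.

(** One period cut cyclically into four pieces; a vertical piece is a single point when its two end
    times coincide. *)
Record two_arcs (R : realType) (L A B : R) (u : R -> R) (t0 t1 t2 t3 : R) : Prop :=
  TwoArcs {
    ta_01 : crossing A B u t0 t1;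
    ta_12 : t1 <= t2;
    ta_23 : crossing A B u t2 t3;
    ta_30 : t3 <= t0 + L;
    ta_B : forall r, t1 <= r <= t2 -> u r = B;
    ta_A : forall r, t3 <= r <= t0 + L -> u r = A }.

(* [t2, t3] and [q2, q3] are the first and the last descending arcs after t1.
   If they differed, both would lie above the lowest arc [t0, t1]; whichever is
   in the middle would have an end on the vertical piece of the curve that joins
   [t0, t1] to the other one. *)
Lemma lowest_arc_two_arcs (R : realType) (L A B : R) (u v : R -> R)
    (t0 tm t1 : R) :
  extremal_loop L A B u v -> crossing A B u t0 t1 -> u t0 = A -> u t1 = B ->
  t0 < tm < t1 -> (forall t, u t = u tm -> v tm <= v t) ->
  exists t2 t3, two_arcs L A B u t0 t1 t2 t3.
Proof.
move=> lp a01 u0 u1 /andP[t0m tm1] vmin.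
have AB := loop_AB lp; have uc := loop_uc lp; have vc := loop_vc lp.
have [t01 _ ins] := a01.
have bd r : u r <> A -> u r <> B -> A < u r < B.
  by move=> /eqP rA /eqP rB; have /andP[h1 h2] := loop_bd lp r;
     rewrite !lt_neqAle h1 h2 rB eq_sym rA.
(* The arc is shorter than a period: u is A again at t0 + L, but nowhere on ]t0, t1]. *)
have t1L : t1 < t0 + L.
  have u0L : u (t0 + L) = A by rewrite (loop_up lp).
  rewrite ltNge; apply/negP => h.
  have := ins (t0 + L); rewrite u0L ltxx andFb ltrDl (loop_L lp) /= => H.
  have : ~ (t0 + L < t1) by move/H.
  move/negP; rewrite -leNgt => h'.
  have e : t1 = t0 + L by apply/eqP; rewrite eq_le h h'.
  by move: AB; rewrite -u1 e u0L ltxx.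
have [|t3 [/andP[t13 t3L] u3 t3min]] := @first_time _ u t1 (t0 + L) A uc.
  by exists (t0 + L); rewrite lexx ltW //= (loop_up lp).
have [|t2 [/andP[t12 t23] u2 t2max]] := @last_time _ u t1 t3 B uc.
  by exists t1; rewrite lexx.
have [|q2 [/andP[t1q2 q2L] uq2 q2max]] := @last_time _ u t1 (t0 + L) B uc.
  by exists t1; rewrite lexx ltW.
have [|q3 [/andP[q23 q3L] uq3 q3min]] := @first_time _ u q2 (t0 + L) A uc.
  by exists (t0 + L); rewrite lexx q2L (loop_up lp).
have ne s t : u s = B -> u t = A -> s <= t -> s < t.
  move=> us ut; rewrite le_eqVlt => /predU1P[e|//].
  by move: AB; rewrite -ut -us e ltxx.
have {}t23 := ne _ _ u2 u3 t23; have {}q23 := ne _ _ uq2 uq3 q23.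
have a23 : crossing A B u t2 t3.
  split=> //; first by right.
  move=> r /andP[h1 h2]; apply: bd.
    by apply: t3min; rewrite h2 (le_trans t12 (ltW h1)).
  by apply: t2max; rewrite h1 ltW.
have aq : crossing A B u q2 q3.
  split=> //; first by right.
  move=> r /andP[h1 h2]; apply: bd.
    by apply: q3min; rewrite h2 ltW.
  by apply: q2max; rewrite h1 (le_trans (ltW h2) q3L).
have uB : forall r, t1 <= r <= t2 -> u r = B.
  apply: plateau (A) _ _ uc _ u1 u2 _ => [s t st e|r /andP[h1 h2]].
    by have [r [? [?|?]]] := loop_crit lp st e; exists r; split=> //; [right|left].
  by apply: t3min; rewrite h1 (le_lt_trans h2 t23).
have uA : forall r, q3 <= r <= t0 + L -> u r = A.
  apply: plateau (B) _ _ uc _ uq3 _ _ => [s t st e||r /andP[h1 h2]].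
  - exact: loop_crit lp _ _ st e.
  - by rewrite (loop_up lp).
  - by apply: q2max; rewrite h2 (lt_le_trans q23 h1).
have t2q2 : t2 <= q2.
  rewrite leNgt; apply/negP => h; apply: (q2max t2) u2.
  by rewrite h (le_trans (ltW t23) t3L).
move: t2q2; rewrite le_eqVlt => /predU1P[e|t2q2].
  exists t2, t3; split=> //.
  suff -> : t3 = q3 by [].
  have h : t3 <= q3.
    rewrite leNgt; apply/negP => h; apply: (t3min q3) uq3.
    by rewrite h (le_trans t12) // e ltW.
  apply/eqP; rewrite eq_le h /= leNgt; apply/negP => h'; apply: (q3min t3) u3.
  by rewrite h' -e ltW.
have t3q2 : t3 < q2.
  rewrite ltNge; apply/negP => h; apply: (t2max q2) uq2.
  by rewrite t2q2.
have [al ali] := arc_inverse_ex lp a01.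
have [be bei] := arc_inverse_ex lp a23.
have [ga gai] := arc_inverse_ex lp aq.
set c := u tm.
have cAB : A < c < B by apply: ins; rewrite t0m.
have cAB' : A <= c <= B by case/andP: cAB => /ltW -> /ltW ->.
have cont a s t : arc_inverse A B u s t a -> continuous (v \o a).
  by move=> ai x; apply: continuous_comp; [exact: inv_cont ai x | exact: vc].
have ab x : A < x < B -> v (al x) <> v (be x).
  by apply: (arcs_disjoint lp a01 ali a23 bei).
have ag x : A < x < B -> v (al x) <> v (ga x).
  by apply: (arcs_disjoint lp a01 ali aq gai).
have bg x : A < x < B -> v (be x) <> v (ga x).
  by apply: (arcs_disjoint lp a23 bei aq gai); lra.
have alc : al c = tm by rewrite (inv_K ali) // !ltW.
have abc : v (al c) < v (be c).
  rewrite lt_neqAle; apply/andP; split; first exact/eqP/ab.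
  by rewrite alc; apply: vmin; rewrite (inv_VK bei).
have agc : v (al c) < v (ga c).
  rewrite lt_neqAle; apply/andP; split; first exact/eqP/ag.
  by rewrite alc; apply: vmin; rewrite (inv_VK gai).
have order a b p0 p1 q0 q1 : arc_inverse A B u p0 p1 a -> arc_inverse A B u q0 q1 b ->
    (forall x, A < x < B -> v (a x) <> v (b x)) -> v (a c) < v (b c) ->
    forall x, A <= x <= B -> v (a x) <= v (b x).
  move=> ia ib dis vab; apply: (le_closed_itv (cont _ _ _ ia) (cont _ _ _ ib) AB) => x xAB.
  by apply/ltW; apply: (graphs_ordered (cont _ _ _ ia) (cont _ _ _ ib) dis cAB vab).
have AA : A <= A <= B by rewrite lexx ltW.
have BB : A <= B <= B by rewrite lexx ltW.
have alA : al A = t0 by rewrite -u0 (inv_K ali) // lexx ltW.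
have alB : al B = t1 by rewrite -u1 (inv_K ali) // lexx ltW.
have beA : be A = t3 by rewrite -u3 (inv_K bei) // lexx ltW.
have beB : be B = t2 by rewrite -u2 (inv_K bei) // lexx ltW.
have gaA : ga A = q3 by rewrite -uq3 (inv_K gai) // lexx ltW.
have gaB : ga B = q2 by rewrite -uq2 (inv_K gai) // lexx ltW.
have [vbg|vgb|e] := ltgtP (v (be c)) (v (ga c)); last by case: (bg c cAB e).
(* Here [be] is in the middle. Its end over A is reached at time t3, and v takes that height again
   on [q3, t0 + L], where u is A. *)
- have [r [/andP[r1 r2] vr]] : exists r, q3 <= r <= t0 + L /\ v r = v t3.
    apply: ivt_segment => //; right; rewrite (loop_vp lp).
    have := order _ _ _ _ _ _ ali bei ab abc A AA.
    have := order _ _ _ _ _ _ bei gai bg vbg A AA.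
    by rewrite alA beA gaA => -> ->.
  case: (@loop_inj _ _ _ _ _ _ lp t3 r) => //; [lra| |by rewrite u3 uA // r1].
  rewrite (le_lt_trans r2) // ltrD2r; lra.
(* Here [ga] is in the middle. Its end over B is reached at time q2, and v takes that height already
   on [t1, t2], where u is B. *)
- have [r [/andP[r1 r2] vr]] : exists r, t1 <= r <= t2 /\ v r = v q2.
    apply: ivt_segment => //; left.
    have := order _ _ _ _ _ _ ali gai ag agc B BB.
    have gb x : A < x < B -> v (ga x) <> v (be x) by move=> /bg h e; exact: h.
    have := order _ _ _ _ _ _ gai bei gb vgb B BB.
    by rewrite alB beB gaB => -> ->.
  case: (@loop_inj _ _ _ _ _ _ lp r q2) => //; [lra| |by rewrite uq2 uB // r1].
  lra.
Qed.

(** * The strip between two graphs *)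

Lemma open_lt_fun (R : realType) (T : topologicalType) (F G : T -> R) :
  continuous F -> continuous G -> open [set p | F p < G p].
Proof.
move=> Fc Gc; have -> : [set p | F p < G p] = (fun p => G p - F p) @^-1` [set y | 0 < y].
  by apply/seteqP; split=> p /=; rewrite subr_gt0.
apply: open_comp => [p _|]; last exact: open_gt.
by apply: continuousB; [exact: Gc | exact: Fc].
Qed.

Lemma closed_le_fun (R : realType) (T : topologicalType) (F G : T -> R) :
  continuous F -> continuous G -> closed [set p | F p <= G p].
Proof.
move=> Fc Gc; have -> : [set p | F p <= G p] = (fun p => G p - F p) @^-1` [set y | 0 <= y].
  by apply/seteqP; split=> p /=; rewrite subr_ge0.
apply: closed_comp => [p _|]; last exact: closed_ge.
by apply: continuousB; [exact: Gc | exact: Fc].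
Qed.

Definition strip (R : realType) (A B : R) (f1 f2 : R -> R) : set (R * R) :=
  [set p | A < p.1 < B /\ f1 p.1 < p.2 < f2 p.1].

Definition closed_strip (R : realType) (A B : R) (f1 f2 : R -> R) : set (R * R) :=
  [set p | A <= p.1 <= B /\ f1 p.1 <= p.2 <= f2 p.1].

(** When f1 < f2 on ]A, B[, these are the two graphs together with the possibly degenerate vertical
    segments over A and B. As a set difference, membership is a matter of inequalities only. *)
Definition strip_boundary (R : realType) (A B : R) (f1 f2 : R -> R) : set (R * R) :=
  closed_strip A B f1 f2 `\` strip A B f1 f2.

Lemma comp_fst_continuous (R : realType) (f : R -> R) :
  continuous f -> continuous (fun p : R * R => f p.1).
Proof.
by move=> fc p; apply: (@continuous_comp _ _ _ fst f); [exact: cvg_fst | exact: fc].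
Qed.

Lemma open_strip (R : realType) (A B : R) (f1 f2 : R -> R) :
  continuous f1 -> continuous f2 -> open (strip A B f1 f2).
Proof.
move=> c1 c2.
have -> : strip A B f1 f2 = ([set p : R * R | A < p.1] `&` [set p | p.1 < B])
    `&` ([set p | f1 p.1 < p.2] `&` [set p | p.2 < f2 p.1]).
  apply/seteqP; split=> p /=; first by move=> [/andP[? ?] /andP[? ?]].
  by move=> [[h1 h2] [h3 h4]]; split; apply/andP.
have fstc : continuous (fun p : R * R => p.1) by move=> p; exact: cvg_fst.
have sndc : continuous (fun p : R * R => p.2) by move=> p; exact: cvg_snd.
have cc (a : R) : continuous (fun _ : R * R => a) by move=> p; exact: cst_continuous.
by apply: openI; apply: openI; apply: open_lt_fun => //; exact: comp_fst_continuous.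
Qed.

Lemma closed_closed_strip (R : realType) (A B : R) (f1 f2 : R -> R) :
  continuous f1 -> continuous f2 -> closed (closed_strip A B f1 f2).
Proof.
move=> c1 c2.
have -> : closed_strip A B f1 f2 = ([set p : R * R | A <= p.1] `&` [set p | p.1 <= B])
    `&` ([set p | f1 p.1 <= p.2] `&` [set p | p.2 <= f2 p.1]).
  apply/seteqP; split=> p /=; first by move=> [/andP[? ?] /andP[? ?]].
  by move=> [[h1 h2] [h3 h4]]; split; apply/andP.
have fstc : continuous (fun p : R * R => p.1) by move=> p; exact: cvg_fst.
have sndc : continuous (fun p : R * R => p.2) by move=> p; exact: cvg_snd.
have cc (a : R) : continuous (fun _ : R * R => a) by move=> p; exact: cst_continuous.
by apply: closedI; apply: closedI; apply: closed_le_fun => //; exact: comp_fst_continuous.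
Qed.

Lemma bounded_closed_strip (R : realType) (A B : R) (f1 f2 : R -> R) :
  continuous f1 -> continuous f2 -> bounded_set (closed_strip A B f1 f2).
Proof.
move=> c1 c2; have [AB|BA] := leP A B; last first.
  rewrite (_ : closed_strip _ _ _ _ = set0); first exact: compact_bounded compact0.
  apply/seteqP; split=> // p [/andP[h1 h2] _].
  by have := le_trans h1 h2; rewrite leNgt BA.
have [x1 _ m1] := EVT_min AB (continuous_subspaceT c1).
have [x2 _ m2] := EVT_max AB (continuous_subspaceT c2).
have sub : closed_strip A B f1 f2 `<=` `[A, B] `*` `[f1 x1, f2 x2].
  move=> p [pAB /andP[p1 p2]]; split; rewrite /= in_itv //=.
  have pI : p.1 \in `[A, B]%R by rewrite in_itv.
  by rewrite (le_trans (m1 _ pI) p1) (le_trans p2 (m2 _ pI)).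
have bd : bounded_set (`[A, B] `*` `[f1 x1, f2 x2]).
  by apply: (@compact_bounded R (R^o * R^o)%type); apply: compact_setX; exact: segment_compact.
by move: bd; apply: sub_boundedr => P; apply: subset_trans.
Qed.

(* The strip is relatively open and closed in the complement of its boundary. *)
Lemma strip_inside (R : realType) (A B : R) (f1 f2 : R -> R) :
  continuous f1 -> continuous f2 ->
  strip A B f1 f2 `<=` inside (strip_boundary A B f1 f2).
Proof.
move=> c1 c2 p pO; have nM : (~` strip_boundary A B f1 f2) p by case.
split=> //; set C := connected_component _ _.
suff CO : C `<=` closed_strip A B f1 f2.
  by move: (bounded_closed_strip A B c1 c2); apply: sub_boundedr => P; apply: subset_trans.
have strip_sub : strip A B f1 f2 `<=` closed_strip A B f1 f2.
  by move=> q [/andP[/ltW h1 /ltW h2] /andP[/ltW h3 /ltW h4]]; split; apply/andP.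
have <- : C `&` strip A B f1 f2 = C; last by move=> q [_ /strip_sub].
apply: (component_connected (A := ~` strip_boundary A B f1 f2) (x := p)).
- by exists p; split=> //; exact: connected_component_refl.
- by exists (strip A B f1 f2) => //; exact: open_strip.
- exists (closed_strip A B f1 f2); first exact: closed_closed_strip.
  apply/seteqP; split=> q [Cq Oq]; split=> //; first exact: strip_sub.
  apply: contrapT => nO.
  by have := connected_component_sub Cq; apply.
Qed.

Lemma pos_near_right0 (R : realType) (h : R -> R) :
  {for 0, continuous h} -> 0 < h 0 -> \forall s \near 0^'+, 0 < h s.
Proof. by move=> /cvg_at_right_filter hc h0; move/cvgr_gt : hc; apply. Qed.

(** In Carathéodory's form h s = q s * s, with q continuous at 0 and q 0 = d, the sign of h to the
    right of 0 is that of q. *)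
Lemma pos_derive_near_right0 (R : realType) (h : R -> R) (d : R) :
  is_derive (0 : R) 1 h d -> h 0 = 0 -> 0 < d -> \forall s \near 0^'+, 0 < h s.
Proof.
move=> hd h0 d0.
have /is_derive1_caratheodory [q [hE qc q0]] := hd.
have qpos : \forall s \near 0^'+, 0 < q s by apply: pos_near_right0; rewrite ?q0.
near=> s.
have := hE s; rewrite h0 !subr0 => ->; apply: mulr_gt0 => //.
by near: s.
Unshelve. all: by end_near. Qed.

Lemma is_derive_along (R : realType) (f : R -> R) (x a d : R) :
  is_derive x 1 f d -> is_derive (0 : R) 1 (fun s => f (x + s * a)) (d * a).
Proof.
move=> fd.
have gd : is_derive (0 : R) 1 (fun s : R => x + s * a) a.
  have := is_deriveD (is_derive_cst x (0 : R) 1)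
    (is_deriveM (is_derive_id (0 : R) 1) (is_derive_cst a (0 : R) 1)).
  by rewrite scaler0 !add0r /GRing.scale /= mulr1.
have fd' : is_derive ((fun s : R => x + s * a) 0) 1 f d by rewrite /= mul0r addr0.
exact: (@is_derive1_comp R f (fun s : R => x + s * a) 0 d a fd' gd).
Qed.

Lemma is_derive_continuous (R : realType) (f : R -> R) (x d : R) :
  is_derive x 1 f d -> {for x, continuous f}.
Proof. by move=> fd; apply/differentiable_continuous/derivable1_diffP. Qed.

(** The condition on n2 - d * n1 says that the vector (n1, n2) points above the tangent of the lower
    graph. Three of the strict inequalities defining the strip hold at s = 0 and persist; the fourth
    is an equality at s = 0 and needs the derivative. *)
Lemma strip_near_lower (R : realType) (A B : R) (f1 f2 : R -> R) (x n1 n2 d : R) :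
  continuous f2 -> A < x < B -> f1 x < f2 x -> is_derive x 1 f1 d ->
  0 < n2 - d * n1 ->
  \forall s \near 0^'+, strip A B f1 f2 (x + s * n1, f1 x + s * n2).
Proof.
move=> c2 /andP[Ax xB] f12 fd pos.
have lin (y a : R) : continuous (fun s : R => y + s * a).
  by move=> s; apply: cvgD; [exact: cvg_cst | apply: cvgM; [exact: cvg_id | exact: cvg_cst]].
have nA : \forall s \near 0^'+, 0 < x + s * n1 - A.
  apply: (@pos_near_right0 R (fun s => x + s * n1 - A)); last by rewrite mul0r addr0 subr_gt0.
  by apply: continuousB; [exact: lin | exact: cst_continuous].
have nB : \forall s \near 0^'+, 0 < B - (x + s * n1).
  apply: (@pos_near_right0 R (fun s => B - (x + s * n1))); last by rewrite mul0r addr0 subr_gt0.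
  by apply: continuousB; [exact: cst_continuous | exact: lin].
have n2' : \forall s \near 0^'+, 0 < f2 (x + s * n1) - (f1 x + s * n2).
  apply: (@pos_near_right0 R (fun s => f2 (x + s * n1) - (f1 x + s * n2))); last by rewrite !mul0r !addr0 subr_gt0.
  have f2c : continuous (f2 \o (fun s => x + s * n1)).
    by move=> s; apply: continuous_comp; [exact: lin | exact: c2].
  by apply: continuousB; [exact: f2c | exact: lin].
have n1' : \forall s \near 0^'+, 0 < (f1 x + s * n2) - f1 (x + s * n1).
  apply: (@pos_derive_near_right0 R (fun s => (f1 x + s * n2) - f1 (x + s * n1)) _ _ _ pos).
    have := is_deriveB (is_derive_along n2 (is_derive_id (f1 x) 1)) (is_derive_along n1 fd).
    by rewrite mul1r.
  by rewrite !mul0r !addr0 subrr.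
near=> s; split; rewrite /= -[X in X && _]subr_gt0 -[X in _ && X]subr_gt0; apply/andP; split;
  by near: s.
Unshelve. all: by end_near. Qed.

(** Reflection in the x1-axis exchanges the roles of the two graphs. *)
Lemma strip_near_upper (R : realType) (A B : R) (f1 f2 : R -> R) (x n1 n2 d : R) :
  continuous f1 -> A < x < B -> f1 x < f2 x -> is_derive x 1 f2 d ->
  n2 - d * n1 < 0 ->
  \forall s \near 0^'+, strip A B f1 f2 (x + s * n1, f2 x + s * n2).
Proof.
move=> c1 xAB f12 fd neg.
have H : \forall s \near 0^'+,
    strip A B (fun y => - f2 y) (fun y => - f1 y) (x + s * n1, - f2 x + s * - n2).
  apply: (@strip_near_lower R A B (fun y => - f2 y) (fun y => - f1 y) x n1 (- n2) (- d)) => //.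
  - by move=> y; apply: continuousN; exact: c1.
  - by rewrite ltrN2.
  - by rewrite mulNr opprK addrC -oppr_lt0 opprD opprK addrC.
move: H; apply: filterS => s [/= h /andP[h1 h2]]; split=> //=.
move: h1 h2; rewrite mulrN -opprD !ltrN2 => -> ->//.
Qed.

(** * Curvature and the tangent angle *)

Lemma C2_is_derive (R : realType) (f : R -> R) (t : R) :
  C2 f -> is_derive t 1 f (f^`() t).
Proof. by move=> [fd _ _]; rewrite derive1E; apply: derivableP. Qed.

Lemma C2_is_derive2 (R : realType) (f : R -> R) (t : R) :
  C2 f -> is_derive t 1 f^`() (f^`(2) t).
Proof. by move=> [_ fd _]; rewrite derive1nS derive1n1 derive1E; apply: derivableP. Qed.

Lemma derive1_is_derive (R : realType) (f : R -> R) (t d : R) :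
  is_derive t 1 f d -> f^`() t = d.
Proof. by move=> fd; rewrite derive1E derive_val. Qed.

Lemma derive1_periodic (R : realType) (f : R -> R) (L t : R) :
  C2 f -> (forall r, f (r + L) = f r) -> f^`() (t + L) = f^`() t.
Proof.
move=> fC fL; symmetry; apply: derive1_is_derive.
have sh : is_derive t 1 (fun r => r + L) 1.
  by have := is_deriveD (is_derive_id t (1 : R)) (is_derive_cst L t 1); rewrite addr0.
have := @is_derive1_comp R f (fun r => r + L) t _ _ (C2_is_derive (t + L) fC) sh.
rewrite mulr1; suff -> : f \o +%R^~ L = f by [].
by apply/funext => r /=; rewrite fL.
Qed.

Definition speed (R : realType) (u v : R -> R) (t : R) : R :=
  Num.sqrt (derive1 u t * derive1 u t + derive1 v t * derive1 v t).

(* The sine of the angle from the x_1-axis to the velocity. *)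
Definition tan_sin (R : realType) (u v : R -> R) (t : R) : R :=
  derive1 v t * (speed u v t)^-1.

(** Signed curvature with respect to the left normal, the unit tangent rotated counterclockwise by a
    quarter turn. *)
Definition left_curvature (R : realType) (u v : R -> R) (t : R) : R :=
  (derive1 u t * derive1n 2 v t - derive1 v t * derive1n 2 u t) / speed u v t ^+ 3.

Definition regular (R : realType) (u v : R -> R) : Prop :=
  forall t, 0 < derive1 u t * derive1 u t + derive1 v t * derive1 v t.

Lemma speed_gt0 (R : realType) (u v : R -> R) (t : R) : regular u v -> 0 < speed u v t.
Proof. by move=> reg; rewrite sqrtr_gt0. Qed.

Lemma speed2 (R : realType) (u v : R -> R) (t : R) : regular u v ->
  speed u v t ^+ 2 = derive1 u t * derive1 u t + derive1 v t * derive1 v t.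
Proof. by move=> reg; rewrite sqr_sqrtr // ltW. Qed.

(** The left side is the derivative of v' / W as the rules of derivation deliver it, with a = u', b
    = v', a2 = u'', b2 = v'' and W the speed. *)
Lemma tangent_angle_identity (R : realType) (W a b a2 b2 : R) :
  W != 0 -> W ^+ 2 = a * a + b * b ->
  b * (- W ^- 2 * ((2 * W)^-1 * (a * a2 + a * a2 + (b * b2 + b * b2)))) + W^-1 * b2
  = a * ((a * b2 - b * a2) / W ^+ 3).
Proof.
move=> W0 WE; transitivity ((W ^+ 2 * b2 - b * (a * a2 + b * b2)) / W ^+ 3); first by field.
by rewrite WE mulrA; congr (_ / _); ring.
Qed.

(** For the tangent angle theta and the left curvature k, theta' is k times the speed and cos theta
    is u' divided by the speed; hence (sin theta)' = u' * k. *)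
Lemma is_derive_tan_sin (R : realType) (u v : R -> R) (t : R) :
  C2 u -> C2 v -> regular u v ->
  is_derive t 1 (tan_sin u v) (derive1 u t * left_curvature u v t).
Proof.
move=> uC vC reg.
have du := C2_is_derive2 t uC; have dv := C2_is_derive2 t vC.
have dq := is_deriveD (is_deriveM du du) (is_deriveM dv dv).
have dW := @is_derive1_comp R Num.sqrt
  (fun r => derive1 u r * derive1 u r + derive1 v r * derive1 v r) t _ _ (is_derive1_sqrt (reg t)) dq.
have W0 := lt0r_neq0 (speed_gt0 t reg).
have dT := is_deriveM dv (@is_deriveV R (speed u v) t _ 1 W0 dW).
apply: is_derive_eq dT _.
rewrite /GRing.scale /= /left_curvature -/(speed u v t).
exact: tangent_angle_identity W0 (speed2 t reg).
Qed.

Lemma tan_sin_continuous (R : realType) (u v : R -> R) :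
  C2 u -> C2 v -> regular u v -> continuous (tan_sin u v).
Proof.
by move=> uC vC reg t; apply: is_derive_continuous (is_derive_tan_sin t uC vC reg).
Qed.

(** Where the tangent is vertical the sine is 1 or -1, and continuity forbids a jump between the
    two. *)
Lemma tan_sin_vertical (R : realType) (u v : R -> R) (a b : R) :
  C2 u -> C2 v -> regular u v -> a <= b ->
  (forall r, a <= r <= b -> derive1 u r = 0) -> tan_sin u v a = tan_sin u v b.
Proof.
move=> uC vC reg ab u0.
have sq r : a <= r <= b -> tan_sin u v r ^+ 2 = 1.
  move=> rab; rewrite exprMn exprVn speed2 // u0 // mul0r add0r -expr2 divff //.
  by have := reg r; rewrite u0 // mul0r add0r => /lt0r_neq0.
have pm r : a <= r <= b -> tan_sin u v r = 1 \/ tan_sin u v r = -1.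
  by move=> /sq /eqP; rewrite sqrf_eq1 => /orP[] /eqP; [left|right].
have Tc := tan_sin_continuous uC vC reg.
have aI : a <= a <= b by rewrite lexx.
have bI : a <= b <= b by rewrite lexx ab.
have n0 : ~ exists t, a <= t <= b /\ tan_sin u v t = 0.
  by move=> [t [/sq + Tt]]; rewrite Tt expr0n /= => /eqP; rewrite eq_sym oner_eq0.
have [Ta|Ta] := pm a aI; have [Tb|Tb] := pm b bI; rewrite Ta Tb //;
  case: n0; apply: ivt_segment => //; rewrite Ta Tb lerN10 ler01; by [left|right].
Qed.

Lemma nonzero_keeps_sign (R : realType) (f : R -> R) (s t c : R) :
  continuous f -> (forall r, s < r < t -> f r <> 0) -> s < c < t ->
  0 < f c -> forall r, s < r < t -> 0 < f r.
Proof.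
move=> fc f0 sct fpos; apply: (@graphs_ordered R (cst 0) f s t c) => //.
- by move=> x; exact: cst_continuous.
- by move=> x /f0 h e; exact: h.
Qed.

(** The mean value theorem gives one point of positive derivative, and a continuous derivative
    without zeros keeps its sign. *)
Lemma rising_derive1_gt0 (R : realType) (u : R -> R) (s t : R) :
  C2 u -> s < t -> u s < u t -> (forall r, s < r < t -> derive1 u r <> 0) ->
  forall r, s < r < t -> 0 < derive1 u r.
Proof.
move=> uC st ust u0.
have uc : continuous u by move=> x; apply: is_derive_continuous (C2_is_derive x uC).
have duc : continuous (derive1 u) by move=> x; apply: is_derive_continuous (C2_is_derive2 x uC).
have [c + cE] := MVT st (fun x _ => C2_is_derive x uC) (continuous_subspaceT uc).
rewrite in_itv /= => sct; apply: (nonzero_keeps_sign duc u0 sct).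
by rewrite -(pmulr_lgt0 _ (x := t - s)) ?subr_gt0 // -cE subr_gt0.
Qed.

Lemma falling_derive1_lt0 (R : realType) (u : R -> R) (s t : R) :
  C2 u -> s < t -> u t < u s -> (forall r, s < r < t -> derive1 u r <> 0) ->
  forall r, s < r < t -> derive1 u r < 0.
Proof.
move=> uC st ust u0.
have uc : continuous u by move=> x; apply: is_derive_continuous (C2_is_derive x uC).
have duc : continuous (fun r => - derive1 u r).
  by move=> x; apply: continuousN; apply: is_derive_continuous (C2_is_derive2 x uC).
have [c + cE] := MVT st (fun x _ => C2_is_derive x uC) (continuous_subspaceT uc).
rewrite in_itv /= => sct r rst; rewrite -oppr_gt0.
apply: (nonzero_keeps_sign duc _ sct _ rst) => [x /u0 + /eqP|].
  by rewrite oppr_eq0 => h /eqP.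
by rewrite oppr_gt0 -(pmulr_llt0 _ (x := t - s)) ?subr_gt0 // -cE subr_lt0.
Qed.

Lemma is_derive_arc_inverse (R : realType) (A B : R) (u al : R -> R) (s t x : R) :
  C2 u -> crossing A B u s t -> arc_inverse A B u s t al -> A < x < B ->
  derive1 u (al x) <> 0 -> is_derive x 1 al (derive1 u (al x))^-1.
Proof.
move=> uC a ai xAB /eqP u0.
have uc : continuous u by move=> y; apply: is_derive_continuous (C2_is_derive y uC).
have /andP[h1 h2] := inv_itvoo a ai xAB.
have xE : u (al x) = x by rewrite (inv_VK ai) //; case/andP: xAB => /ltW -> /ltW ->.
rewrite -{1}xE; apply: is_derive_inverse (C2_is_derive (al x) uC) u0.
- near=> r; apply: (inv_K ai); apply/andP; split; apply/ltW; near: r.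
    exact: lt_nbhsr.
  exact: lt_nbhsl.
- by near=> r; exact: uc.
Unshelve. all: by end_near. Qed.

(** The left unit normal is the witness; that it points inward is the only condition involving the
    position of M. *)
Lemma is_curvature_left (R : realType) (M : set (R * R)) (L : R)
    (g : R -> R * R) (u v : R -> R) (t : R) :
  u = fst \o g -> v = snd \o g -> closed_C2_param M L g -> regular u v ->
  (\forall s \near 0^'+, inside M (u t + s * (- derive1 v t / speed u v t),
                                  v t + s * (derive1 u t / speed u v t))) ->
  is_curvature M (u t, v t) (left_curvature u v t).
Proof.
move=> uE vE gM reg near_in.
have W0 := lt0r_neq0 (speed_gt0 t reg); have WE := speed2 t reg.
exists L, g, t, (- derive1 v t / speed u v t, derive1 u t / speed u v t); split=> //.
- by rewrite uE vE /= -surjective_pairing.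
- split.
  + rewrite /dot /=; transitivity ((derive1 u t * derive1 u t + derive1 v t * derive1 v t) / speed u v t ^+ 2).
      by field.
    by rewrite -WE divff // expf_neq0.
  + by rewrite /dot /velocity -uE -vE /=; field.
  + by move: near_in; rewrite uE vE.
- rewrite /dot /velocity /acceleration -uE -vE -[X in _ / X]/(derive1 u t * derive1 u t + derive1 v t * derive1 v t) -WE /left_curvature /=.
  by field.
Qed.

(** * Symmetry *)

Lemma strip_boundary_symmetric (R : realType) (A B l : R) (f1 f2 : R -> R) :
  (forall x, A <= x <= B -> f1 x + f2 x = 2 * l) ->
  symmetric_about_horizontal (strip_boundary A B f1 f2) l.
Proof.
move=> mid.
have refl p : strip_boundary A B f1 f2 p ->
    strip_boundary A B f1 f2 (p.1, 2 * l - p.2).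
  move=> [[pAB /andP[p1 p2]] nO]; have m := mid _ pAB; split.
    by split=> //=; apply/andP; split; lra.
  move=> [/= pAB' /andP[p1' p2']]; apply: nO; split=> //.
  by apply/andP; split; lra.
apply/seteqP; split=> [_ [p pM <-]|p pM]; first exact: refl.
exists (p.1, 2 * l - p.2); first exact: refl.
by rewrite /= subKr -surjective_pairing.
Qed.

Lemma periodic_int (R : realType) (T : Type) (f : R -> T) (L : R) :
  (forall t, f (t + L) = f t) -> forall (k : int) t, f (t + k%:~R * L) = f t.
Proof.
move=> fL.
have fn (n : nat) t : f (t + n%:R * L) = f t.
  elim: n t => [|n IH] t; first by rewrite mul0r addr0.
  by rewrite -natr1 mulrDl mul1r addrA fL IH.
case=> n t; first exact: fn.
by rewrite NegzE mulrNz mulNr -(fn n.+1 (t - _)) subrK.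
Qed.

Lemma period_shift (R : realType) (L a t : R) : 0 < L ->
  exists k : int, a <= t + k%:~R * L < a + L.
Proof.
move=> L0; exists (- Num.floor ((t - a) / L)).
have /andP[h1 h2] := floor_itv ((t - a) / L).
move: h1 h2; rewrite intrD mulr1z ler_pdivlMr // ltr_pdivrMr // intrN mulNr.
move: (_%:~R) => k h1; rewrite mulrDl mul1r => h2.
by apply/andP; split; lra.
Qed.

(** Translating s and t by multiples of L into [0, L[ shows that equal images force t - s to be an
    integer multiple of L, and none lies strictly between 0 and L. *)
Lemma closed_param_inj (R : realType) (M : set (R * R)) (L : R) (g : R -> R * R) (s t : R) :
  closed_C2_param M L g -> s < t -> t < s + L -> g s <> g t.
Proof.
move=> [L0 _ _ [gL ginj] _] st tsL gst.
have [k] := period_shift 0 s L0; rewrite add0r => kI.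
have [m] := period_shift 0 t L0; rewrite add0r => mI.
have e : s + k%:~R * L = t + m%:~R * L.
  apply: ginj; last by rewrite !(periodic_int gL).
    by rewrite inE /= in_itv /=.
  by rewrite inE /= in_itv /=.
have {}e : t - s = (k - m)%:~R * L by rewrite rmorphB /= mulrBl; lra.
have : 0 < (k - m)%:~R * L < 1 * L by rewrite -e mul1r; apply/andP; split; lra.
rewrite pmulr_lgt0 // ltr_pM2r // ltr0z => /andP[h1 h2].
by move: h2; rewrite -[1]/(1%:~R) ltr_int ltNge -gtz0_ge1 h1.
Qed.

(** On a vertical piece u is constant, so v is injective, hence monotone: it stays between the ends
    of the two graphs and, by the intermediate value theorem, takes every height between them. *)
Lemma two_arcs_boundary (R : realType) (L A B : R) (u v : R -> R)
    (t0 t1 t2 t3 : R) (al be : R -> R) :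
  extremal_loop L A B u v -> two_arcs L A B u t0 t1 t2 t3 ->
  u t0 = A -> u t1 = B ->
  arc_inverse A B u t0 t1 al -> arc_inverse A B u t2 t3 be ->
  (forall x, A < x < B -> v (al x) < v (be x)) ->
  range (fun t => (u t, v t)) = strip_boundary A B (v \o al) (v \o be).
Proof.
move=> lp ta u0 u1 ai bi lt12.
have [t01 _ _] := ta_01 ta; have [t23 _ _] := ta_23 ta.
have t12 := ta_12 ta; have t3L := ta_30 ta.
have AB := loop_AB lp; have uc := loop_uc lp; have vc := loop_vc lp.
have u2 : u t2 = B by rewrite (ta_B ta) // t12 lexx.
have u3 : u t3 = A by rewrite (ta_A ta) // t3L lexx.
have alA : al A = t0 by rewrite -u0 (inv_K ai) // lexx ltW.
have alB : al B = t1 by rewrite -u1 (inv_K ai) // lexx ltW.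
have beA : be A = t3 by rewrite -u3 (inv_K bi) // lexx ltW.
have beB : be B = t2 by rewrite -u2 (inv_K bi) // lexx ltW.
have cont a s t : arc_inverse A B u s t a -> continuous (v \o a).
  by move=> i x; apply: continuous_comp; [exact: inv_cont i x | exact: vc].
have le12 x : A <= x <= B -> v (al x) <= v (be x).
  by apply: (le_closed_itv (cont _ _ _ ai) (cont _ _ _ bi) AB) => y /lt12/ltW.
have AA : A <= A <= B by rewrite lexx ltW.
have BB : A <= B <= B by rewrite lexx ltW.
have vB : v t1 <= v t2 by have := le12 B BB; rewrite alB beB.
have vA : v t0 <= v t3 by have := le12 A AA; rewrite alA beA.
have noA y : ~ strip A B (v \o al) (v \o be) (A, y) by move=> [/=]; rewrite ltxx.
have noB y : ~ strip A B (v \o al) (v \o be) (B, y) by move=> [/=]; rewrite ltxx andbF.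
apply/seteqP; split=> [_ [t _ <-]|[x y] [[/= xAB /andP[y1 y2]] nO]].
  (* Translate t into the period starting at t0, where the four pieces follow one another. *)
  have [k /andP[]] := period_shift t0 t (loop_L lp).
  rewrite -(periodic_int (loop_up lp) k) -(periodic_int (loop_vp lp) k).
  move: (t + _) => {}t t0t tL.
  have [tt1|t1t] := leP t t1.
    have alt : al (u t) = t by rewrite (inv_K ai) // t0t.
    split; last by move=> [_ /andP[/=]]; rewrite alt ltxx.
    split=> /=; first exact: loop_bd lp t.
    by rewrite alt lexx -{1}alt le12 // (loop_bd lp).
  have [tt2|t2t] := leP t t2.
    have ut : u t = B by rewrite (ta_B ta) // ltW.
    rewrite ut; split; last exact: noB.
    split=> //=; rewrite alB beB.
    have vinj : {in `[t1, t2]%R &, injective v}.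
      apply: injective_segment => s r h1 h2 h3; apply: (loop_inj lp) => //; first by lra.
      by rewrite !(ta_B ta) // ?h1 ?h3 ?(le_trans h1 (ltW h2)) // (le_trans (ltW h2) h3).
    have mono := segment_continuous_inj_le vB (continuous_subspaceT vc) vinj.
    have tI : t \in `[t1, t2]%R by rewrite in_itv /= tt2 ltW.
    by rewrite !mono ?tt2 ?(ltW t1t) // in_itv /= lexx t12.
  have [tt3|t3t] := leP t t3.
    have bet : be (u t) = t by rewrite (inv_K bi) // tt3 ltW.
    split; last by move=> [_ /andP[/=]]; rewrite bet ltxx.
    split=> /=; first exact: loop_bd lp t.
    by rewrite bet lexx -{2}bet le12 // (loop_bd lp).
  have ut : u t = A by rewrite (ta_A ta) // !ltW.
  rewrite ut; split; last exact: noA.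
  split=> //=; rewrite alA beA -(loop_vp lp t0).
  have vinj : {in `[t3, t0 + L]%R &, injective v}.
    apply: injective_segment => s r h1 h2 h3; apply: (loop_inj lp) => //; first by lra.
    by rewrite !(ta_A ta) // ?h1 ?h3 ?(le_trans h1 (ltW h2)) // (le_trans (ltW h2) h3).
  have vA' : v (t0 + L) <= v t3 by rewrite (loop_vp lp).
  have mono := segment_continuous_inj_ge vA' (continuous_subspaceT vc) vinj.
  have tI : t \in `[t3, t0 + L]%R by rewrite in_itv /= !ltW.
  by rewrite !mono ?(ltW tL) ?(ltW t3t) // in_itv /= lexx t3L.
have [xA|xA] := eqVneq x A.
  have [t [tI vt]] : exists t, t3 <= t <= t0 + L /\ v t = y.
    by apply: ivt_segment => //; right; rewrite (loop_vp lp) -alA -beA -xA y1 y2.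
  by exists t => //; rewrite vt (ta_A ta) // xA.
have [xB|xB] := eqVneq x B.
  have [t [tI vt]] : exists t, t1 <= t <= t2 /\ v t = y.
    by apply: ivt_segment => //; left; rewrite -alB -beB -xB y1 y2.
  by exists t => //; rewrite vt (ta_B ta) // xB.
have xAB' : A < x < B.
  by move: xAB => /andP[h1 h2]; rewrite !lt_neqAle h1 h2 xB eq_sym xA.
have [ya|ya] := eqVneq y (v (al x)).
  by exists (al x) => //; rewrite (inv_VK ai) // ya.
have [yb|yb] := eqVneq y (v (be x)).
  by exists (be x) => //; rewrite (inv_VK bi) // yb.
case: nO; split=> //=.
by rewrite !lt_neqAle y1 y2 yb eq_sym ya.
Qed.

(** * Constancy of the midline *)

(** Two directions with the same sine, one pointing right and the other left, are mirror images in
    the vertical axis. *)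
Lemma opposite_slopes (R : realType) (a b a' b' : R) :
  0 < a -> a' < 0 ->
  b / Num.sqrt (a * a + b * b) = b' / Num.sqrt (a' * a' + b' * b') ->
  b / a + b' / a' = 0.
Proof.
move=> a0 a'0; set q := a * a + b * b; set q' := a' * a' + b' * b'.
have q0 : 0 < q by rewrite /q ltr_pwDl ?mulr_gt0 // -expr2 sqr_ge0.
have q'0 : 0 < q' by rewrite /q' ltr_pwDl ?nmulr_rgt0 // -expr2 sqr_ge0.
have W2 := sqr_sqrtr (ltW q0); have W2' := sqr_sqrtr (ltW q'0).
have W0 : 0 < Num.sqrt q by rewrite sqrtr_gt0.
have W0' : 0 < Num.sqrt q' by rewrite sqrtr_gt0.
move: W2 W2' W0 W0'; move: (Num.sqrt q) (Num.sqrt q') => W W' W2 W2' W0 W0' bE.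
have Wn := lt0r_neq0 W0; have Wn' := lt0r_neq0 W0'.
(* The cosines have equal squares because the sines agree. *)
have aE : a / W = - (a' / W').
  have sq : (a / W) ^+ 2 = (a' / W') ^+ 2.
    have h1 : (a / W) ^+ 2 = 1 - (b / W) ^+ 2.
      by rewrite !exprMn !exprVn -(divff (expf_neq0 2 Wn)) -mulrBl W2; congr (_ / _); rewrite /q; ring.
    have h2 : (a' / W') ^+ 2 = 1 - (b' / W') ^+ 2.
      by rewrite !exprMn !exprVn -(divff (expf_neq0 2 Wn')) -mulrBl W2'; congr (_ / _); rewrite /q'; ring.
    by rewrite h1 h2 bE.
  move/eqP: sq; rewrite eqf_sqr => /orP[/eqP e|/eqP //].
  have p1 : 0 < a / W by rewrite divr_gt0.
  have p2 : a' / W' < 0 by rewrite nmulr_rlt0 // invr_gt0.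
  by move: p1; rewrite e ltNge ltW.
have an : a != 0 by rewrite gt_eqF.
have an' : a' != 0 by rewrite lt_eqF.
have -> : b / a = (b / W) / (a / W) by field; rewrite Wn an.
have -> : b' / a' = (b' / W') / (a' / W') by field; rewrite Wn' an'.
by rewrite aE bE invrN mulrN addNr.
Qed.

(* Along each arc the x-derivative of tan_sin is the left curvature, so the
   difference of tan_sin on the two arcs is nondecreasing; it vanishes at both
   ends because the tangent stays vertical on the pieces x = A and x = B. *)
Lemma midline_const (R : realType) (L A B : R) (u v : R -> R)
    (t0 t1 t2 t3 : R) (al be : R -> R) :
  C2 u -> C2 v -> regular u v ->
  extremal_loop L A B u v -> two_arcs L A B u t0 t1 t2 t3 ->
  u t0 = A -> u t1 = B ->
  arc_inverse A B u t0 t1 al -> arc_inverse A B u t2 t3 be ->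
  (forall t, u t = A \/ u t = B -> derive1 u t = 0) ->
  (forall t, t0 < t < t1 -> 0 < derive1 u t) ->
  (forall t, t2 < t < t3 -> derive1 u t < 0) ->
  (forall x, A < x < B -> left_curvature u v (be x) <= left_curvature u v (al x)) ->
  exists l, forall x, A <= x <= B -> v (al x) + v (be x) = 2 * l.
Proof.
move=> uC vC reg lp ta u0 u1 ai bi crit pos neg curv.
have [t01 _ _] := ta_01 ta; have [t23 _ _] := ta_23 ta.
have t12 := ta_12 ta; have t3L := ta_30 ta.
have AB := loop_AB lp; have uc := loop_uc lp; have vc := loop_vc lp.
have u2 : u t2 = B by rewrite (ta_B ta) // t12 lexx.
have u3 : u t3 = A by rewrite (ta_A ta) // t3L lexx.
have alA : al A = t0 by rewrite -u0 (inv_K ai) // lexx ltW.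
have alB : al B = t1 by rewrite -u1 (inv_K ai) // lexx ltW.
have beA : be A = t3 by rewrite -u3 (inv_K bi) // lexx ltW.
have beB : be B = t2 by rewrite -u2 (inv_K bi) // lexx ltW.
have alI x : A < x < B -> 0 < derive1 u (al x) by move=> /(inv_itvoo (ta_01 ta) ai)/pos.
have beI x : A < x < B -> derive1 u (be x) < 0 by move=> /(inv_itvoo (ta_23 ta) bi)/neg.
have dal x : A < x < B -> is_derive x 1 al (derive1 u (al x))^-1.
  by move=> xAB; apply: (is_derive_arc_inverse uC (ta_01 ta) ai xAB); apply/eqP; rewrite gt_eqF ?alI.
have dbe x : A < x < B -> is_derive x 1 be (derive1 u (be x))^-1.
  by move=> xAB; apply: (is_derive_arc_inverse uC (ta_23 ta) bi xAB); apply/eqP; rewrite lt_eqF ?beI.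
have Tc := tan_sin_continuous uC vC reg.
(* A difference, because the upper arc is traversed leftwards: there u' < 0, and [tan_sin] is the
   opposite of f2' / sqrt (1 + f2'^2). *)
pose phi := (tan_sin u v \o al) - (tan_sin u v \o be).
have phiE x : phi x = tan_sin u v (al x) - tan_sin u v (be x) by [].
have dphi x : A < x < B ->
    is_derive x 1 phi (left_curvature u v (al x) - left_curvature u v (be x)).
  move=> xAB; have h1 := lt0r_neq0 (alI _ xAB).
  have h2 : derive1 u (be x) != 0 by rewrite lt_eqF ?beI.
  have := is_deriveB (is_derive1_comp (is_derive_tan_sin (al x) uC vC reg) (dal x xAB))
                     (is_derive1_comp (is_derive_tan_sin (be x) uC vC reg) (dbe x xAB)).
  (* The factor u' in the derivative of [tan_sin] cancels the derivative 1 / u' of the inverse of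
     u. *)
  by rewrite mulrAC divff // mul1r mulrAC divff // mul1r.
have phic : continuous phi.
  move=> x; apply: continuousB; apply: continuous_comp; rewrite /=; try exact: Tc.
    exact: inv_cont ai x.
  exact: inv_cont bi x.
have phiB : phi B = 0.
  rewrite phiE alB beB (tan_sin_vertical uC vC reg t12) ?subrr // => r rI.
  by apply: crit; right; rewrite (ta_B ta).
have phiA : phi A = 0.
  rewrite phiE alA beA (tan_sin_vertical uC vC reg t3L) => [|r rI].
    (* The vertical piece over A ends at t0 + L; periodicity of the derivatives leads back to t0. *)
    rewrite /tan_sin /speed !derive1_periodic ?subrr //; [exact: loop_up lp | exact: loop_vp lp].
  by apply: crit; left; rewrite (ta_A ta).
have phi0 x : A < x < B -> phi x = 0.
  move=> /andP[Ax xB].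
  have ndec : forall y z, A <= y -> y <= z -> z <= B -> phi y <= phi z.
    apply: ger0_derive1_ndecr; last exact: continuous_subspaceT.
      by move=> y; rewrite in_itv /= => /dphi [].
    move=> y; rewrite in_itv /= => yAB.
    by rewrite (derive1_is_derive (dphi y yAB)) subr_ge0 curv.
  apply/eqP; rewrite eq_le -{1}phiB -{1}phiA.
  by rewrite !ndec // ltW.
pose f := (v \o al) + (v \o be).
have df x : A < x < B -> is_derive x 1 f 0.
  move=> xAB; have := is_deriveD (is_derive1_comp (C2_is_derive (al x) vC) (dal x xAB))
                     (is_derive1_comp (C2_is_derive (be x) vC) (dbe x xAB)).
  rewrite opposite_slopes //; [exact: alI | exact: beI |].
  by apply/eqP; rewrite -subr_eq0; apply/eqP; exact: phi0 xAB.
have fc : continuous f.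
  move=> x; apply: continuousD; apply: continuous_comp; rewrite /=; try exact: vc.
    exact: inv_cont ai x.
  exact: inv_cont bi x.
(* The axis is halfway between the ends of the two graphs over A; since f has zero derivative, every
   x gives the same height. *)
exists (f A / 2) => x /andP[Ax xB].
have [|c _] := @MVT_segment R f (cst 0) A x Ax _ (continuous_subspaceT fc).
  by move=> y; rewrite in_itv /= => /andP[h1 h2]; apply: df; rewrite h1 (lt_le_trans h2).
rewrite mul0r => /eqP; rewrite subr_eq0 => /eqP fx.
by rewrite mulrC divfK ?pnatr_eq0 // -fx.
Qed.

(** * Reversal of the parametrization *)

Lemma C2_continuous (R : realType) (f : R -> R) : C2 f -> continuous f.
Proof. by move=> fC x; apply: is_derive_continuous (C2_is_derive x fC). Qed.

Lemma is_derive_opp_arg (R : realType) (f : R -> R) (t d : R) :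
  is_derive (- t) 1 f d -> is_derive t 1 (fun r => f (- r)) (- d).
Proof.
move=> fd; have := @is_derive1_comp R f -%R t _ _ fd (is_deriveNid t 1).
by rewrite mulrN1.
Qed.

Lemma derive1_opp_arg (R : realType) (f : R -> R) :
  C2 f -> derive1 (fun r => f (- r)) = (fun t => - derive1 f (- t)).
Proof.
move=> fC; apply/funext => t; apply: derive1_is_derive.
exact: is_derive_opp_arg (C2_is_derive (- t) fC).
Qed.

Lemma C2_opp_arg (R : realType) (f : R -> R) : C2 f -> C2 (fun r => f (- r)).
Proof.
move=> fC; have d2 (t : R) : is_derive t 1 (derive1 (fun r => f (- r))) (derive1n 2 f (- t)).
  rewrite derive1_opp_arg //.
  have := is_deriveN (is_derive_opp_arg (C2_is_derive2 (- t) fC)).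
  by rewrite opprK.
split.
- by move=> t; have [] := is_derive_opp_arg (C2_is_derive (- t) fC).
- by move=> t; have [] := d2 t.
- have -> : derive1n 2 (fun r => f (- r)) = derive1n 2 f \o -%R.
    by apply/funext => t; apply: (derive1_is_derive (d2 t)).
  have [_ _ fc] := fC.
  by move=> t; apply: continuous_comp; [exact: opp_continuous | exact: fc].
Qed.

(** This allows the lowest arc to be taken from left to right. Injectivity passes through
    [closed_param_inj], since t -> - t does not preserve [0, L[. *)
Lemma closed_C2_param_reverse (R : realType) (M : set (R * R)) (L : R) (g : R -> R * R) :
  closed_C2_param M L g -> closed_C2_param M L (fun t => g (- t)).
Proof.
move=> gM; have [L0 [uC vC] reg [gL _] gr] := gM.
have du := derive1_opp_arg uC; have dv := derive1_opp_arg vC.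
split; first exact: L0.
- by split; [exact: (C2_opp_arg uC) | exact: (C2_opp_arg vC)].
- move=> t; apply: contra (reg (- t)) => /eqP e.
  have := congr1 fst e; have := congr1 snd e.
  rewrite /velocity /= => /eqP h2 /eqP h1; move: h1 h2.
  rewrite [X in X == 0](congr1 (@^~ t) du) [X in _ -> X == 0 -> _](congr1 (@^~ t) dv) !oppr_eq0.
  by move=> /eqP -> /eqP ->.
- split=> [t|s t]; first by rewrite -(gL (- (t + L))) opprD subrK.
  rewrite !inE /= !in_itv /= => /andP[s0 sL] /andP[t0' tL] e.
  have [st|ts|//] := ltgtP s t.
    by case: (@closed_param_inj R M L g (- t) (- s) gM) => //; lra.
  by case: (@closed_param_inj R M L g (- s) (- t) gM) => //; lra.
- rewrite -gr; apply/seteqP; split=> _ [t _ <-]; first by exists (- t).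
  by exists (- t); rewrite //= opprK.
Qed.

(** * Consequences of the geometric hypotheses on M *)

Lemma param_regular (R : realType) (M : set (R * R)) (L : R) (g : R -> R * R) :
  closed_C2_param M L g -> regular (fst \o g) (snd \o g).
Proof.
move=> [_ _ reg _ _] t; rewrite lt_neqAle eq_sym addr_ge0 -?expr2 ?sqr_ge0 // andbT.
apply: contra (reg t); rewrite paddr_eq0 ?sqr_ge0 // !sqrf_eq0 /velocity.
by move=> /andP[/eqP -> /eqP ->].
Qed.

Lemma vertical_tangent (R : realType) (M : set (R * R)) (L : R) (g : R -> R * R) (t : R) :
  closed_C2_param M L g -> derive1 (fst \o g) t = 0 ->
  is_tangent_line M (vertical_line (g t).1).
Proof.
move=> gM u0; exists L, g, t; split=> //.
have v0 : derive1 (snd \o g) t != 0.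
  have := param_regular gM t; rewrite u0 mul0r add0r -expr2 => /lt0r_neq0.
  by rewrite sqrf_eq0.
apply/seteqP; split=> [[x y]|_ [s _ <-]]; last first.
  by rewrite /vertical_line /= /velocity /= u0 mulr0 addr0.
rewrite /vertical_line /= => ->; exists ((y - (g t).2) / derive1 (snd \o g) t) => //.
by rewrite /velocity /= u0 mulr0 addr0 divfK // addrC subrK.
Qed.

Lemma extremum_derive1_0 (R : realType) (u : R -> R) (A B t : R) :
  C2 u -> (forall r, A <= u r <= B) -> u t = A \/ u t = B -> derive1 u t = 0.
Proof.
move=> uC bd ut; apply: derive1_is_derive.
have tI : t \in `]t - 1, t + 1[%R by rewrite in_itv /= ltrBlDr ltrDl ltr01.
have h : t - 1 <= t + 1 by lra.
have du r : r \in `]t - 1, t + 1[%R -> derivable u r 1.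
  by move=> _; have [] := C2_is_derive r uC.
case: ut => ut.
  by apply: (derive1_at_min h du tI) => r _; rewrite ut; case/andP: (bd r).
by apply: (derive1_at_max h du tI) => r _; rewrite ut; case/andP: (bd r).
Qed.

Lemma param_extremal_loop (R : realType) (M : set (R * R)) (L A B : R) (g : R -> R * R) :
  closed_C2_param M L g ->
  (forall c : R, is_tangent_line M (vertical_line c) -> on_one_side_of_vertical M c) ->
  (forall t, A <= (g t).1 <= B) ->
  (exists t, (g t).1 = A) -> (exists t, (g t).1 = B) ->
  extremal_loop L A B (fst \o g) (snd \o g) /\
  forall t, derive1 (fst \o g) t = 0 -> (g t).1 = A \/ (g t).1 = B.
Proof.
move=> gM side bd [ta ua] [tb ub].
have [L0 [uC vC] reg [gL _] gr] := gM.
have crit t : derive1 (fst \o g) t = 0 -> (g t).1 = A \/ (g t).1 = B.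
  move=> /(vertical_tangent gM)/side; have inM r : M (g r) by rewrite -gr; exists r.
  have /andP[h1 h2] := bd t.
  case=> sub; [right|left]; apply/eqP; rewrite eq_le ?h1 ?h2 /= ?andbT.
    by rewrite -ub; exact: (sub _ (inM tb)).
  by rewrite -ua; exact: (sub _ (inM ta)).
have rolle (f : R -> R) s t : C2 f -> s < t -> f s = f t -> exists r, s < r < t /\ derive1 f r = 0.
  move=> fC st e.
  have [|r + d] := Rolle st _ (continuous_subspaceT (C2_continuous fC)) e.
    by move=> x _; have [] := C2_is_derive x fC.
  by rewrite in_itv /= => rI; exists r; split=> //; exact: derive1_is_derive.
split=> //; split=> //.
(* If B <= A then u is constant, and Rolle's theorem for v over one period gives a time of zero
   velocity, against regularity. *)
- rewrite ltNge; apply/negP => BA.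
  have uA t : (fst \o g) t = A.
    by have /andP[h1 h2] := bd t; apply/eqP; rewrite eq_le h1 (le_trans h2 BA).
  have [|r [_ v0]] := rolle _ 0 L vC L0; first by rewrite /= -[in RHS](add0r L) gL.
  have u0 := extremum_derive1_0 uC bd (or_introl (uA r)).
  by have := reg r; rewrite /velocity u0 v0 eqxx.
- exact: C2_continuous.
- exact: C2_continuous.
- by move=> t; rewrite /= gL.
- by move=> t; rewrite /= gL.
- move=> s t st tsL us vs; apply: (closed_param_inj gM st tsL).
  by rewrite [LHS]surjective_pairing [RHS]surjective_pairing; congr pair.
- move=> s t st us; have [r [rI /crit h]] := rolle _ _ _ uC st us.
  by exists r.
Qed.

(** The lower arc runs rightwards and the upper one leftwards, so on both the left normal points
    into the strip, and the curvature hypothesis becomes an inequality between left curvatures. *)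
Lemma rising_lowest_symmetric (R : realType) (M : set (R * R)) (L A B : R)
    (g : R -> R * R) (t0 tm t1 : R) :
  closed_C2_param M L g ->
  extremal_loop L A B (fst \o g) (snd \o g) ->
  (forall t, derive1 (fst \o g) t = 0 -> (g t).1 = A \/ (g t).1 = B) ->
  (forall x1 a b ka kb : R, a < b -> M (x1, a) -> M (x1, b) ->
     is_curvature M (x1, a) ka -> is_curvature M (x1, b) kb -> kb <= ka) ->
  crossing A B (fst \o g) t0 t1 -> (g t0).1 = A -> (g t1).1 = B ->
  t0 < tm < t1 -> (forall t, (g t).1 = (g tm).1 -> (g tm).2 <= (g t).2) ->
  exists l, symmetric_about_horizontal M l.
Proof.
move=> gM lp crit curv a01 u0 u1 tmI vmin.
have reg := param_regular gM.
have [_ [uC vC] _ _ gr] := gM.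
have [t2 [t3 ta]] := lowest_arc_two_arcs lp a01 u0 u1 tmI vmin.
have a23 := ta_23 ta.
have [al ai] := arc_inverse_ex lp a01; have [be bi] := arc_inverse_ex lp a23.
set u := fst \o g in lp crit uC reg a01 ta a23 ai bi *.
set v := snd \o g in lp vC reg *.
have AB := loop_AB lp; have vc := loop_vc lp.
have [t01 _ ins] := a01; have [t23 _ ins'] := a23.
have cont a s t : arc_inverse A B u s t a -> continuous (v \o a).
  by move=> i x; apply: continuous_comp; [exact: inv_cont i x | exact: vc].
have dis : forall x, A < x < B -> v (al x) <> v (be x).
  by apply: (arcs_disjoint lp a01 ai a23 bi); [exact: ta_12 ta | exact: ta_30 ta].
have cAB : A < u tm < B by exact: ins.
have lt12 : forall x, A < x < B -> v (al x) < v (be x).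
  apply: (graphs_ordered (cont _ _ _ ai) (cont _ _ _ bi) dis cAB).
  rewrite lt_neqAle; apply/andP; split; first exact/eqP/dis.
  have /andP[/ltW h1 /ltW h2] := tmI; have /andP[/ltW h3 /ltW h4] := cAB.
  rewrite /= (inv_K ai) ?h1 //; apply: vmin.
  by rewrite -[LHS]/(u (be (u tm))) (inv_VK bi) ?h3.
have ME : M = strip_boundary A B (v \o al) (v \o be).
  rewrite -(two_arcs_boundary lp ta u0 u1 ai bi lt12) -gr.
  suff -> : (fun t => (u t, v t)) = g by [].
  by apply/funext => t; rewrite [RHS]surjective_pairing.
have u2 : u t2 = B by rewrite (ta_B ta) // (ta_12 ta) lexx.
have u3 : u t3 = A by rewrite (ta_A ta) // (ta_30 ta) lexx.
have nc r : A < u r < B -> derive1 u r <> 0.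
  by move=> /andP[h1 h2] /crit; rewrite -[(g r).1]/(u r) => -[e|e]; move: h1 h2; rewrite e ltxx.
have pos : forall t, t0 < t < t1 -> 0 < derive1 u t.
  apply: (rising_derive1_gt0 uC t01); first by rewrite -/u [u t0]u0 [u t1]u1.
  by move=> r /ins/nc.
have neg : forall t, t2 < t < t3 -> derive1 u t < 0.
  apply: (falling_derive1_lt0 uC t23); first by rewrite u2 u3.
  by move=> r /ins'/nc.
have inM t : M (u t, v t) by rewrite -gr; exists t; rewrite // [LHS]surjective_pairing.
have dal x : A < x < B -> is_derive x 1 (v \o al) (derive1 v (al x) / derive1 u (al x)).
  move=> xAB; apply: is_derive1_comp (C2_is_derive (al x) vC) _.
  by apply: (is_derive_arc_inverse uC a01 ai xAB); apply/eqP; rewrite gt_eqF ?pos // (inv_itvoo a01 ai).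
have dbe x : A < x < B -> is_derive x 1 (v \o be) (derive1 v (be x) / derive1 u (be x)).
  move=> xAB; apply: is_derive1_comp (C2_is_derive (be x) vC) _.
  by apply: (is_derive_arc_inverse uC a23 bi xAB); apply/eqP; rewrite lt_eqF ?neg // (inv_itvoo a23 bi).
have into := strip_inside (A := A) (B := B) (cont _ _ _ ai) (cont _ _ _ bi).
(* For the left normal (- b / W, a / W) and the slope d = b / a, the quantity n2 - d * n1 is W / a.
   Its sign is that of u': positive on the lower arc, negative on the upper one. *)
have nE a b W : W != 0 -> a != 0 -> W ^+ 2 = a * a + b * b -> a / W - b / a * (- b / W) = W / a :> R.
  move=> W0 a0 WE; transitivity ((a * a + b * b) / (W * a)); first by field; rewrite W0 a0.
  by rewrite -WE; field; rewrite W0 a0.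
have [l mid] : exists l, forall x, A <= x <= B -> v (al x) + v (be x) = 2 * l.
  apply: (midline_const uC vC reg lp ta u0 u1 ai bi) => //.
    by move=> t; apply: (extremum_derive1_0 uC (loop_bd lp)).
  move=> x xAB; have xAB' : A <= x <= B by case/andP: xAB => /ltW -> /ltW ->.
  have ua : u (al x) = x by rewrite (inv_VK ai).
  have ub : u (be x) = x by rewrite (inv_VK bi).
  have pa := pos _ (inv_itvoo a01 ai xAB); have nb := neg _ (inv_itvoo a23 bi xAB).
  have Wa := speed_gt0 (al x) reg; have Wb := speed_gt0 (be x) reg.
  apply: (curv x (v (al x)) (v (be x)) _ _ (lt12 x xAB)).
  - by rewrite -{1}ua; exact: inM.
  - by rewrite -{1}ub; exact: inM.
  - rewrite -{1}ua; apply: (is_curvature_left erefl erefl gM reg).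
    rewrite -/u -/v ua ME.
    apply: filterS (strip_near_lower (cont _ _ _ bi) xAB (lt12 x xAB) (dal x xAB) _).
      by move=> s; exact: into.
    by rewrite nE ?gt_eqF ?speed2 // divr_gt0.
  - rewrite -{1}ub; apply: (is_curvature_left erefl erefl gM reg).
    rewrite -/u -/v ub ME.
    apply: filterS (strip_near_upper (cont _ _ _ ai) xAB (lt12 x xAB) (dbe x xAB) _).
      by move=> s; exact: into.
    by rewrite nE ?(gt_eqF Wb) ?(lt_eqF nb) ?speed2 // pmulr_rlt0 // invr_lt0.
by exists l; rewrite ME; exact: strip_boundary_symmetric.
Qed.

Lemma periodic_range (R : realType) (u : R -> R) (L : R) :
  0 < L -> continuous u -> (forall t, u (t + L) = u t) ->
  exists A B, [/\ forall t, A <= u t <= B, exists t, u t = A & exists t, u t = B].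
Proof.
move=> L0 uc uL.
have [a _ amin] := EVT_min (ltW L0) (continuous_subspaceT uc).
have [b _ bmax] := EVT_max (ltW L0) (continuous_subspaceT uc).
exists (u a), (u b); split; [|by exists a|by exists b] => t.
have [k] := period_shift 0 t L0; rewrite add0r => /andP[h1 h2].
have I : t + k%:~R * L \in `[0, L]%R by rewrite in_itv /= h1 ltW.
by rewrite -(periodic_int uL k t) amin // bmax.
Qed.

(** A lowest point on the vertical line halfway between the extremes lies at no extreme of u, so the
    nearest extreme times on either side of it bound an arc. *)
Lemma lowest_crossing (R : realType) (L A B : R) (u v : R -> R) :
  extremal_loop L A B u v -> (exists t, u t = A) -> (exists t, u t = B) ->
  exists t0 tm t1, [/\ crossing A B u t0 t1, t0 < tm < t1
    & forall t, u t = u tm -> v tm <= v t].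
Proof.
move=> lp [ta ua] [tb ub].
have L0 := loop_L lp; have AB := loop_AB lp.
have uc := loop_uc lp; have vc := loop_vc lp.
pose c := (A + B) / 2; have Ac : A < c by rewrite /c; lra.
have cB : c < B by rewrite /c; lra.
have [s us] : exists s, u s = c.
  have [h|h] := leP ta tb.
    have [|s [_ us]] := ivt_segment (y := c) uc h; last by exists s.
    by left; rewrite ua ub !ltW.
  have [|s [_ us]] := ivt_segment (y := c) uc (ltW h); last by exists s.
  by right; rewrite ua ub !ltW.
have [|tm [_ um tmin]] := @level_min R u v s (s + L) c uc vc.
  by exists s; rewrite lexx lerDl ltW.
(* Periodicity extends minimality from one period to all times. *)
have vmin t : u t = u tm -> v tm <= v t.
  have [k /andP[h1 h2]] := period_shift s t L0 => ut.
  rewrite -(periodic_int (loop_vp lp) k t); apply: tmin; first by rewrite h1 ltW.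
  by rewrite (periodic_int (loop_up lp)) ut.
(* The zeros of w are exactly the times where u is A or B, so one function serves to find both ends
   of the arc, whichever extremes they are. *)
pose w t := (u t - A) * (u t - B).
have wc : continuous w.
  by move=> t; apply: cvgM; apply: cvgB; try exact: cvg_cst; exact: uc.
have w0 t : w t <> 0 -> A < u t < B.
  move=> wt; have /andP[h1 h2] := loop_bd lp t; rewrite !lt_neqAle h1 h2 !andbT.
  apply/andP; split; apply/eqP => e; apply: wt; rewrite /w.
    by rewrite -e subrr mul0r.
  by rewrite e subrr mulr0.
have wE t : w t = 0 -> u t = A \/ u t = B.
  by move=> /eqP; rewrite mulf_eq0 !subr_eq0 => /orP[] /eqP; [left|right].
have wa : w ta = 0 by rewrite /w ua subrr mul0r.
have wm : w tm <> 0.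
  by apply/eqP; rewrite /w um mulf_neq0 // subr_eq0 ?(gt_eqF Ac) ?(lt_eqF cB).
have wL t : w (t + L) = w t by rewrite /w (loop_up lp).
have [|t1 [/andP[mt1 _] w1 min1]] := @first_time R w tm (tm + L) 0 wc.
  have [k /andP[h1 h2]] := period_shift tm ta L0.
  by exists (ta + k%:~R * L); rewrite h1 ltW // (periodic_int wL).
have [|t0 [/andP[_ t0m] w0' max0]] := @last_time R w (tm - L) tm 0 wc.
  have [k] := period_shift (tm - L) ta L0; rewrite subrK => /andP[h1 h2].
  by exists (ta + k%:~R * L); rewrite h1 ltW // (periodic_int wL).
have {}t0m : t0 < tm.
  by rewrite lt_neqAle t0m andbT; apply/eqP => e; apply: wm; rewrite -e.
have {}mt1 : tm < t1.
  by rewrite lt_neqAle mt1 andbT; apply/eqP => e; apply: wm; rewrite e.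
have ins r : t0 < r < t1 -> A < u r < B.
  move=> /andP[h1 h2]; apply: w0; have [h|h] := leP r tm.
    by apply: max0; rewrite h1.
  by apply: min1; rewrite h2 ltW.
exists t0, tm, t1; split=> //; last by rewrite t0m.
split=> //; first exact: lt_trans mt1.
(* Equal values at both ends would force, by [loop_crit], an extreme value strictly between them. *)
have ne : u t0 <> u t1.
  move=> e; have [r [rI ur]] := loop_crit lp (lt_trans t0m mt1) e.
  by have := ins r rI; case: ur => ->; rewrite ltxx ?andbF.
by case: (wE _ w0') (wE _ w1) => e0 [] e1; [case: ne|left|right|case: ne]; rewrite ?e0 ?e1.
Qed.

Unset Implicit Arguments.

Theorem theorem1p4 (R : realType) (M : set (R * R))
  (M_curve : closed_C2_embedded_curve M)
  (M_one_side : forall c : R, is_tangent_line M (vertical_line c) ->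
     on_one_side_of_vertical M c)
  (M_curvature : forall x1 a b ka kb : R, a < b ->
     M (x1, a) -> M (x1, b) ->
     is_curvature M (x1, a) ka -> is_curvature M (x1, b) kb -> kb <= ka) :
  exists lambda0 : R, symmetric_about_horizontal M lambda0.
Proof.
have [L [g gM]] := M_curve.
have [L0 [uC _] _ [gL _] _] := gM.
have uL t : (fst \o g) (t + L) = (fst \o g) t by rewrite /= gL.
have [A [B [bd exA exB]]] := periodic_range L0 (C2_continuous uC) uL.
have [lp crit] := param_extremal_loop gM M_one_side bd exA exB.
have [t0 [tm [t1 [a01 tmI vmin]]]] := lowest_crossing lp exA exB.
have [t01 [[u0 u1]|[u0 u1]] ins] := a01.
  exact: (rising_lowest_symmetric gM lp crit M_curvature a01 u0 u1 tmI vmin).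
(* The lowest arc runs from B to A. Reversing the parametrization exchanges its ends and changes
   neither M nor the hypotheses on it. *)
have gM' := closed_C2_param_reverse gM.
have [[ta ua] [tb ub]] := (exA, exB).
have exA' : exists t, (g (- t)).1 = A by exists (- ta); rewrite opprK.
have exB' : exists t, (g (- t)).1 = B by exists (- tb); rewrite opprK.
have [lp' crit'] := param_extremal_loop gM' M_one_side (fun t => bd (- t)) exA' exB'.
apply: (rising_lowest_symmetric (t0 := - t1) (tm := - tm) (t1 := - t0) gM' lp' crit' M_curvature).
- split; first by rewrite ltrN2.
    by left; rewrite /= !opprK.
  by move=> r /andP[h1 h2]; apply: ins; apply/andP; split; lra.
- by rewrite opprK.
- by rewrite opprK.
- by move: tmI => /andP[h1 h2]; rewrite !ltrN2 h2.
- by move=> t; rewrite opprK; apply: vmin.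
Qed.
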